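(* For each integer $n\ge 3$ there exists a continuous monotone function $g:\mathbb{R}^n\to\mathbb{R}$ such that $\mathcal{F}(\{g\},\{0\})$ has order type $\varphi(1,0,\ldots,0)$, where the argument list consists of $1$ followed by $n$ zeros (so $\varphi$ here is the $(n+1)$-ary Veblen function).
   Context: Monotone means nondecreasing in each coordinate. For a set $G$ of monotone functions (each $g\in G$ of arity $k_g$) and $P\subseteq\mathbb{R}$, $\mathcal{F}(G,P)$ is the inclusion-least set $\mathcal{F}\subseteq\mathbb{R}$ containing $P$ such that whenever $g\in G$, $x_1,\ldots,x_{k_g}\in\mathcal{F}$ and $g(x_1,\ldots,x_{k_g})>\max_i x_i$, then $g(x_1,\ldots,x_{k_g})\in\mathcal{F}$. The $m$-ary Veblen function is characterized as follows: $\varphi(\alpha_1,\ldots,\alpha_m)$ is the least ordinal $\beta$ of the form $\omega^\gamma$ such that $\varphi(\alpha_1,\ldots,\alpha_{k-1},\alpha'_k,\alpha'_{k+1},\ldots,\alpha'_m)<\beta$ for all $1\le k\le m$, all $\alpha'_k<\alpha_k$, and all $\alpha'_{k+1},\ldots,\alpha'_m<\beta$. *)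

(* Defs.v *)
From mathcomp Require Import all_boot all_order all_algebra.
From mathcomp Require Import all_classical all_reals all_analysis.

Set Implicit Arguments.
Unset Strict Implicit.
Unset Printing Implicit Defensive.

Import Order.TTheory GRing.Theory Num.Theory.
Import numFieldNormedType.Exports.

Local Open Scope classical_set_scope.
Local Open Scope ring_scope.

(* [Osup f] denotes the least ordinal strictly above all the [f i].  The same
   ordinal has many such presentations: equality of ordinals is [oeq], and
   order is [ole], [olt]. *)
Inductive Ord : Type := Osup (X : Type) of X -> Ord.

Fixpoint ole (a b : Ord) : Prop :=
  match a, b with
  | Osup X f, Osup Y g => forall i, exists j, ole (f i) (g j)
  end.

Definition olt (a b : Ord) : Prop :=
  match b with Osup Y g => exists j, ole a (g j) end.

Definition oeq (a b : Ord) : Prop := ole a b /\ ole b a.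

Definition oidx (a : Ord) : Type := match a with Osup X _ => X end.

Definition osub (a : Ord) : oidx a -> Ord :=
  match a with Osup X f => f end.

(* Non-strict supremum of a family. *)
Definition olub (X : Type) (f : X -> Ord) : Ord :=
  @Osup {i : X & oidx (f i)} (fun p => osub (projT2 p)).

Definition ozero : Ord := @Osup False (False_rect Ord).
Definition osucc (a : Ord) : Ord := @Osup unit (fun=> a).
Definition oone : Ord := osucc ozero.
Definition omega : Ord := @Osup nat (fun n => iter n osucc ozero).

(* a + b is the least ordinal >= a and > a + b' for all b' < b. *)
Fixpoint oadd (a b : Ord) : Ord :=
  match b with
  | Osup Y g => @Osup (oidx a + Y)%type
      (fun s => match s with inl i => osub i | inr j => oadd a (g j) end)
  end.

(* a * b is the supremum of a * b' + a for b' < b. *)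
Fixpoint omul (a b : Ord) : Ord :=
  match b with
  | Osup Y g => olub (fun j => oadd (omul a (g j)) a)
  end.

(* For a > 0, a ^ b is the supremum of 1 and of the a ^ b' * a for b' < b. *)
Fixpoint oexp (a b : Ord) : Ord :=
  match b with
  | Osup Y g => olub (fun s : option Y =>
      match s with None => oone | Some j => omul (oexp a (g j)) a end)
  end.

Definition oleast (P : Ord -> Prop) (b : Ord) : Prop :=
  P b /\ forall c, P c -> ole b c.

Definition veblen_closed (m : nat) (phi : ('I_m -> Ord) -> Ord)
    (a : 'I_m -> Ord) (b : Ord) : Prop :=
  (exists c, oeq b (oexp omega c)) /\
  forall (k : 'I_m) (a' : 'I_m -> Ord),
    (forall j : 'I_m, (j < k)%N -> oeq (a' j) (a j)) ->
    olt (a' k) (a k) ->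
    (forall j : 'I_m, (k < j)%N -> olt (a' j) b) ->
    olt (phi a') b.

Definition is_veblen (m : nat) (phi : ('I_m -> Ord) -> Ord) : Prop :=
  forall a, oleast (veblen_closed phi a) (phi a).

Lemma ole_refl a : ole a a.
Proof. by elim: a => X f IH /= i; exists i. Qed.

Lemma ole_trans b a c : ole a b -> ole b c -> ole a c.
Proof.
elim: a b c => X f IH [Y g] [Z h] /= ab bc i.
have [j ij] := ab i; have [k jk] := bc j.
by exists k; apply: IH ij jk.
Qed.

Lemma ole_osub a b : ole a b <-> forall i : oidx a, olt (osub i) b.
Proof. by case: a b => [X f] [Y g]. Qed.

Lemma olt_osub a b : olt a b <-> exists j : oidx b, ole a (osub j).
Proof. by case: b. Qed.

Lemma osub_lt a (i : oidx a) : olt (osub i) a.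
Proof. by apply/olt_osub; exists i; apply: ole_refl. Qed.

Lemma olt_ole a b : olt a b -> ole a b.
Proof.
elim: a b => X f IH [Y g] /= [j]; case E: (g j) => [Z h] /= H i.
have [k ik] := H i; exists j; rewrite E.
by apply: IH => /=; exists k.
Qed.

Lemma ole_lt_trans b a c : ole a b -> olt b c -> olt a c.
Proof.
move=> ab /olt_osub[j bj]; apply/olt_osub; exists j; exact: ole_trans bj.
Qed.

Lemma olt_le_trans b a c : olt a b -> ole b c -> olt a c.
Proof.
by move=> /olt_osub[j aj] /ole_osub /(_ j); apply: ole_lt_trans.
Qed.

Lemma olt_trans b a c : olt a b -> olt b c -> olt a c.
Proof. by move=> ab /olt_ole; apply: olt_le_trans. Qed.

Lemma ole_or_lt a b : ole a b \/ olt b a.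
Proof.
elim: a b => X f IH b.
have [|] := pselect (exists i, ole b (f i)); first by right.
move=> H; left; apply/ole_osub => /= i.
elim: b H => Y g IHb H.
have {}H : ~ ole (Osup g) (f i) by move=> ?; apply: H; exists i.
have : exists j, ~ olt (g j) (f i).
  by apply/existsNP => H'; apply: H; apply/ole_osub.
by move=> [j Hj]; apply/olt_osub; exists j; case: (IH i (g j)).
Qed.

Lemma olt_wf : well_founded olt.
Proof.
suff H a : forall b, ole b a -> Acc olt b by move=> a; apply: H (ole_refl a).
elim: a => X f IH b ba; split => c cb.
by have /olt_osub[i ci] := olt_le_trans cb ba; apply: IH ci.
Qed.

Lemma olt_irr a : ~ olt a a.
Proof. by elim: a / (olt_wf a) => a _ IH aa; apply: (IH a). Qed.

Lemma oeq_refl a : oeq a a. Proof. by split; apply: ole_refl. Qed.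

Lemma oeq_sym a b : oeq a b -> oeq b a. Proof. by case. Qed.

Lemma oeq_trans b a c : oeq a b -> oeq b c -> oeq a c.
Proof. by move=> [? ?] [? ?]; split; apply: (@ole_trans b). Qed.

Lemma oleast_ex (P : Ord -> Prop) b : P b -> exists c, oleast P c.
Proof.
elim: b / (olt_wf b) => b _ IH Pb.
have [[c [cb Pc]]|H] := pselect (exists c, olt c b /\ P c); first exact: IH Pc.
exists b; split=> // c Pc; have [//|cb] := ole_or_lt b c.
by case: H; exists c.
Qed.

Lemma olub_le X (f : X -> Ord) i : ole (f i) (olub f).
Proof.
apply/ole_osub => j; apply/olt_osub.
by exists (existT _ i j); apply: ole_refl.
Qed.

Lemma olub_lt X (f : X -> Ord) a : olt a (olub f) <-> exists i, olt a (f i).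
Proof.
split; first by move=> /olt_osub[[i j] aj]; exists i; apply/olt_osub; exists j.
by move=> [i ai]; apply: olt_le_trans (olub_le f i).
Qed.

Lemma ole_addl a b : ole a (oadd a b).
Proof.
case: b => Y g; apply/ole_osub => i; apply/olt_osub.
by exists (inl i); apply: ole_refl.
Qed.

Lemma olt_add a b c : olt b c -> olt (oadd a b) (oadd a c).
Proof.
have mono b' : forall c, ole b' c -> ole (oadd a b') (oadd a c).
  elim: b' => X f IH [Y g] bc [i|i]; first by exists (inl i); apply: ole_refl.
  by have [j ij] := bc i; exists (inr j); apply: IH.
by case: c => J g [j bj]; exists (inr j); apply: mono.
Qed.

Lemma ole_addr a b : ole b (oadd a b).
Proof. by elim: b => X f IH i; exists (inr i); apply: IH. Qed.

Lemma olt_mul_omega a : olt ozero a -> olt a (omul a omega).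
Proof.
move=> a0; apply/olub_lt; exists 1%N => /=.
apply: (@ole_lt_trans (oadd (omul a oone) ozero)); last exact: olt_add.
apply: ole_trans (ole_addl _ _); apply: ole_trans (olub_le _ tt).
exact: ole_addr.
Qed.

Lemma oexp_gt0 b : olt ozero (oexp omega b).
Proof. by case: b => X f; apply/olub_lt; exists None; exists tt. Qed.

Lemma omul_le a b c : ole a b -> ole (omul a c) (omul b c).
Proof.
have add_le x y z t : ole x y -> ole z t -> ole (oadd x z) (oadd y t).
  move=> xy; elim: z t => X f IH [Y g] zt; apply/ole_osub => -[i|i].
    exact: olt_le_trans (osub_lt i) (ole_trans xy (ole_addl y (Osup g))).
  by have [j ij] := zt i; exists (inr j); apply: IH.
move=> ab; elim: c => X f IH; apply/ole_osub => -[i x].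
apply/olub_lt; exists i.
exact: olt_le_trans (osub_lt x) (add_le _ _ _ _ (IH i) ab).
Qed.

Lemma oexp_le b c : ole b c -> ole (oexp omega b) (oexp omega c).
Proof.
elim: b c => X f IH [Y g] bc; apply/ole_osub => -[[i|] x]; last first.
  by apply/olub_lt; exists None; apply: (osub_lt x).
have [j ij] := bc i; apply/olub_lt; exists (Some j).
exact: olt_le_trans (osub_lt x) (omul_le _ (IH i _ ij)).
Qed.

Lemma ole_exp b : ole b (oexp omega b).
Proof.
elim: b => X f IH; apply/ole_osub => i; apply/olub_lt; exists (Some i).
by apply: ole_lt_trans (IH i) _; apply: olt_mul_omega; apply: oexp_gt0.
Qed.

Lemma oexp_lub X (f : X -> Ord) a :
  inhabited X -> olt a (oexp omega (olub f)) ->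
  exists i, olt a (oexp omega (f i)).
Proof.
move=> [x0] /olub_lt[[[i x]|] ax].
  exists i; move: x ax => /=; case: (f i) => Y g /= y ay.
  by apply/olub_lt; exists (Some y).
have [? ax0] := ax; exists x0; exact: ole_lt_trans ax0 (oexp_gt0 _).
Qed.

(* Every ordinal below [a] is equal to some [odesc p], [p : opath a]. *)
Fixpoint opath (a : Ord) : Type :=
  match a with Osup X f => {i : X & option (opath (f i))} end.

Fixpoint odesc (a : Ord) : opath a -> Ord :=
  match a with
  | Osup X f => fun p =>
      match projT2 p with None => f (projT1 p) | Some q => odesc q end
  end.

Lemma odescP a b : olt b a -> exists p : opath a, oeq b (odesc p).
Proof.
elim: a => X f IH [i bi].
have [ib|/IH[p bp]] := ole_or_lt (f i) b.
  by exists (existT _ i None).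
by exists (existT _ i (Some p)).
Qed.

Definition opick (P : Ord -> Prop) : Ord :=
  if pselect (exists x, P x) is left p then sval (cid p) else ozero.

Lemma opickP (P : Ord -> Prop) b : P b -> P (opick P).
Proof.
by move=> Pb; rewrite /opick; case: pselect => [p|[]]; [case: cid|exists b].
Qed.

Section Lex.
Variable m : nat.
Implicit Types a b : 'I_m -> Ord.

Definition lexlt a b : Prop := exists k : 'I_m,
  (forall j : 'I_m, (j < k)%N -> oeq (a j) (b j)) /\ olt (a k) (b k).

Lemma lexlt_wf : well_founded lexlt.
Proof.
have minS (S : ('I_m -> Ord) -> Prop) : (exists a, S a) ->
    exists2 a, S a & forall b, S b -> ~ lexlt b a.
  move=> Sn0.
  suff /(_ m)[a Sa H] : forall n, exists2 a, S a & forall b, S b ->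
      forall k : 'I_m, (k < n)%N ->
      (forall j : 'I_m, (j < k)%N -> oeq (b j) (a j)) -> ~ olt (b k) (a k).
    by exists a => // b Sb [k [k1 k2]]; apply: (H b Sb k).
  elim=> [|n [a Sa H]]; first by case: Sn0 => a; exists a.
  have [nm|mn] := ltnP n m; last first.
    by exists a => // b Sb k _; apply: H => //; apply: leq_trans mn.
  pose N := Ordinal nm.
  pose T x := exists b, [/\ S b, forall j : 'I_m, (j < n)%N -> oeq (b j) (a j)
    & x = b N].
  have [_ [[b [Sb ba ->]] bmin]] : exists x, oleast T x.
    apply: (@oleast_ex T (a N)); exists a; split=> // j _; exact: oeq_refl.
  exists b => // c Sc k; rewrite ltnS leq_eqVlt => /predU1P[kn|kn] cb.
    have -> : k = N by apply: val_inj.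
    move=> cbN; apply: (@olt_irr (c N)); apply: olt_le_trans cbN _; apply: bmin.
    exists c; split=> // j jn; apply: oeq_trans (ba j jn).
    by apply: cb; rewrite kn.
  move=> cbk; apply: (H c Sc k kn).
    by move=> j jk; apply: oeq_trans (cb j jk) (ba j (ltn_trans jk kn)).
  by apply: olt_le_trans cbk _; have [] := ba k kn.
move=> a; apply: contrapT => Ha.
have [b Hb bmin] := minS (fun a => ~ Acc lexlt a) (ex_intro _ a Ha).
apply: Hb; split=> c cb; apply: contrapT => Hc; exact: bmin Hc cb.
Qed.

Definition vstep a (rec : forall b, lexlt b a -> Ord) : Ord :=
  let phi b := match pselect (lexlt b a) with
    | left p => rec b p | right _ => ozero end in
  opick (oleast (veblen_closed phi a)).

Definition vphi : ('I_m -> Ord) -> Ord := Fix lexlt_wf (fun=> Ord) vstep.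

Lemma eq_veblen_closed phi psi a : (forall b, lexlt b a -> phi b = psi b) ->
  veblen_closed phi a = veblen_closed psi a.
Proof.
move=> E; apply/funext => c; apply/propext.
by split=> -[? H]; split=> // k b ba bk bc; [rewrite -E|rewrite E];
  by [exists k | apply: H ba bk bc].
Qed.

Lemma vphiE a : vphi a = opick (oleast (veblen_closed vphi a)).
Proof.
rewrite {1}/vphi Fix_eq; last first.
  move=> x f g fg; congr vstep.
  by apply: functional_extensionality_dep => y;
    apply: functional_extensionality_dep => p.
rewrite /vstep; congr (opick (oleast _)).
by apply: eq_veblen_closed => b ba; case: pselect.
Qed.

Lemma vphi_oeq a b : (forall i, oeq (a i) (b i)) -> vphi a = vphi b.
Proof.
move=> ab; rewrite !vphiE; congr (opick (oleast _)).
apply/funext => c; apply/propext; split=> -[? H]; split=> // k a' pre a'k;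
  apply: H => // [j jk|]; first by apply: oeq_trans (pre j jk) (oeq_sym (ab j)).
- by apply: olt_le_trans a'k _; have [] := ab k.
- by apply: oeq_trans (pre j jk) (ab j).
- by apply: olt_le_trans a'k _; have [] := ab k.
Qed.

Section Closure.
Variable a : 'I_m -> Ord.

Definition vtup c (p : {k : 'I_m & (opath (a k) * ('I_m -> opath c))%type}) :
    'I_m -> Ord := let: existT k (x, y) := p in
  fun j => if (j < k)%N then a j else if j == k then odesc x else odesc (y j).

Definition vsup c : Ord := Osup (fun p => vphi (@vtup c p)).

Fixpoint vgam n : Ord := match n with
  | 0 => ozero
  | n.+1 => olub (fun b : bool => if b then vgam n else vsup (oexp omega (vgam n)))
  end.

Lemma vgam_le n p : (n <= p)%N -> ole (vgam n) (vgam p).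
Proof.
move=> /subnK <-; elim: (p - n)%N => [|q IH]; first exact: ole_refl.
by apply: ole_trans IH _; apply: (olub_le _ true).
Qed.

Lemma vsup_lt c (k : 'I_m) b :
  (forall j : 'I_m, (j < k)%N -> oeq (b j) (a j)) -> olt (b k) (a k) ->
  olt ozero c ->
  (forall j : 'I_m, (k < j)%N -> olt (b j) c) -> olt (vphi b) (vsup c).
Proof.
move=> pre bk c0 bc; have [x bx] := odescP bk; have [z _] := odescP c0.
have /choice[y Hy] : forall j : 'I_m, exists q : opath c,
    (k < j)%N -> oeq (b j) (odesc q).
  by move=> j; have [/bc/odescP[q]|] := ltnP k j; [exists q|exists z].
apply/olt_osub; exists (existT _ k (x, y)) => /=.
rewrite (@vphi_oeq b (vtup (existT _ k (x, y)))); first exact: ole_refl.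
move=> j /=; case: (ltngtP j k) => [/pre//|kj|/val_inj->].
  by case: eqP => [jk|_]; [rewrite jk ltnn in kj|exact: Hy].
by rewrite eqxx.
Qed.

Lemma vclosed_ex : exists c, veblen_closed vphi a c.
Proof.
exists (oexp omega (olub vgam)); split; first by exists (olub vgam); apply: oeq_refl.
move=> k b pre bk bc.
have /choice[N HN] : forall j : 'I_m, exists n,
    (k < j)%N -> olt (b j) (oexp omega (vgam n)).
  move=> j; have [/bc|] := ltnP k j; last by exists 0%N.
  by move=> /(oexp_lub (inhabits 0%N))[n]; exists n.
pose n := (\max_j N j)%N.
apply: olt_le_trans (oexp_le (olub_le vgam n.+1)).
apply: olt_le_trans (ole_exp _).
apply: olt_le_trans (olub_le _ false).
apply: (vsup_lt pre bk); first exact: oexp_gt0.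
move=> j kj; apply: olt_le_trans (HN j kj) _; apply: oexp_le; apply: vgam_le.
exact: leq_bigmax.
Qed.

End Closure.
End Lex.

Lemma is_veblen_ex m : exists phi : ('I_m -> Ord) -> Ord, is_veblen phi.
Proof.
exists (@vphi m) => a; have [c ac] := vclosed_ex a.
have [b ab] := oleast_ex ac.
by rewrite vphiE; apply: (opickP ab).
Qed.

Lemma is_veblen_uniq m (phi psi : ('I_m -> Ord) -> Ord) :
  is_veblen phi -> is_veblen psi -> forall a, oeq (phi a) (psi a).
Proof.
move=> Hphi Hpsi; elim/(well_founded_ind (@lexlt_wf m)) => a IH.
have [[Pe Pc] Pmin] := Hphi a; have [[Qe Qc] Qmin] := Hpsi a.
split; [apply: Pmin|apply: Qmin]; split=> // k b pre bk bc.
- have /IH[le _] : lexlt b a by exists k.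
  by apply: ole_lt_trans le _; apply: (Qc k).
- have /IH[_ le] : lexlt b a by exists k.
  by apply: ole_lt_trans le _; apply: (Pc k).
Qed.

Definition veblen (m : nat) : ('I_m -> Ord) -> Ord := sval (cid (is_veblen_ex m)).

Lemma veblenP m : is_veblen (@veblen m).
Proof. by rewrite /veblen; case: cid. Qed.

Section Generated.
Variable R : realType.

Definition mv_monotone (k : nat) (g : 'rV[R]_k -> R) : Prop :=
  forall (i : 'I_k) (x y : 'rV[R]_k),
    (forall j, j != i -> x 0 j = y 0 j) -> x 0 i <= y 0 i -> g x <= g y.

Definition mvfun : Type := {k : nat & 'rV[R]_k -> R}.

(* [max_i x_i < g x] is written [forall i, x_i < g x]. *)
Definition gen_closed (G : set mvfun) (F : set R) : Prop :=
  forall g : mvfun, G g -> forall x : 'rV[R]_(projT1 g),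
    (forall i, F (x 0 i)) -> (forall i, x 0 i < projT2 g x) ->
    F (projT2 g x).

Definition generated (G : set mvfun) (P : set R) : set R :=
  smallest (gen_closed G) P.

(* [X], with the order of the reals, is order-isomorphic to the set of ordinals
   below [a]. *)
Definition has_order_type (X : set R) (a : Ord) : Prop :=
  exists f : R -> Ord,
    (forall x y, X x -> X y -> x < y <-> olt (f x) (f y)) /\
    (forall b, olt b a <-> exists2 x, X x & oeq (f x) b).

Lemma generated_closed G P : gen_closed G (generated G P).
Proof.
move=> g Gg x Fx xg F FP; have [Fcl _] := FP; apply: Fcl => // i.
exact: (Fx i F FP).
Qed.

End Generated.

(* Main.v *)
(** Let [V] be the (n+1)-ary Veblen function and [tau = V(1, 0, ..., 0)].  On
ordinals put
  [vsum a = max (a_2 + 1 + a_1, sup_(x < a_0) V(0, x, a_1, ..., a_(n-1)))].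
Then [vsum] is monotone, [tau] is closed under [vsum], and every [d] with
[0 < d < tau] is [vsum a] for some [a_0, ..., a_(n-1) < d].  If
[d <= x + 1 + y] for some [x, y < d], the least such [y] gives equality.
Otherwise [d] is additively principal, hence a power of [omega]; as [d < tau],
some tuple [a] below [d] has [d <= V(0, a)], and for the lexicographically
least such tuple minimality of [V] gives equality.  So 0 generates exactly the
ordinals below [tau] under [vsum].  For [a_0], [a_1], [a_2] to be distinct
coordinates one needs [n >= 3].

In particular [tau] is countable, so the ordinals below [tau] embed in [0, 1]
with a gap below every point.  In such an image every limit point is a limit
from the left only, and this makes every bounded monotone function on the
grid extend to a continuous monotone function on R^n. *)
Require Import Defs.
From mathcomp Require Import all_boot all_order all_algebra.
From mathcomp Require Import all_classical all_reals all_analysis.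
From mathcomp Require Import lra.
Set Implicit Arguments.
Unset Strict Implicit.
Unset Printing Implicit Defensive.
Import Order.TTheory GRing.Theory Num.Theory.
Import numFieldNormedType.Exports.
Local Open Scope classical_set_scope.
Local Open Scope ring_scope.

(** * Order, addition and additively principal ordinals *)

Lemma ole0o a : ole ozero a.
Proof. by apply/ole_osub => -[]. Qed.

Lemma olt0 a : ~ olt a ozero.
Proof. by move=> /olt_osub[[]]. Qed.

Lemma oltNge a b : olt a b <-> ~ ole b a.
Proof.
split=> [ab ba|nba]; first exact: (olt_irr (olt_le_trans ab ba)).
by have [] := ole_or_lt b a.
Qed.

Lemma olt_succ a b : olt a (osucc b) <-> ole a b.
Proof. by split=> [[]//|ab]; exists tt. Qed.

Lemma ole_succ a b : ole (osucc a) b <-> olt a b.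
Proof.
split=> [|ab]; first by apply: olt_le_trans; apply/olt_succ; apply: ole_refl.
by apply/ole_osub.
Qed.

Lemma oleP a b : ole a b <-> forall c, olt c a -> olt c b.
Proof.
split=> [ab c ca|H]; first exact: olt_le_trans ca ab.
by apply/ole_osub => i; apply: H; apply: osub_lt.
Qed.

Lemma oadd_le a b c d : ole a b -> ole c d -> ole (oadd a c) (oadd b d).
Proof.
move=> ab; elim: c d => X f IH [Y g] cd; apply/ole_osub => -[i|i].
  exact: olt_le_trans (osub_lt i) (ole_trans ab (ole_addl b (Osup g))).
by have [j ij] := cd i; exists (inr j); apply: IH.
Qed.

Lemma olt_addP a b c : olt c (oadd a b) <->
  olt c a \/ exists2 b', olt b' b & ole c (oadd a b').
Proof.
split.
  case: b => Y g [[i|j] ci]; first by left; apply/olt_osub; exists i.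
  by right; exists (g j) => //; exists j; apply: ole_refl.
move=> [ca|[d db cd]]; first exact: olt_le_trans ca (ole_addl a b).
exact: ole_lt_trans cd (olt_add a db).
Qed.

Lemma oadd_ole a b c :
  ole a c -> (forall b', olt b' b -> olt (oadd a b') c) -> ole (oadd a b) c.
Proof.
move=> ac H; apply/oleP => d /olt_addP[da|[b' /H b'c db]].
  exact: olt_le_trans da ac.
exact: ole_lt_trans db b'c.
Qed.

Lemma oadd_assoc_le a b c : ole (oadd a (oadd b c)) (oadd (oadd a b) c).
Proof.
elim/(well_founded_ind olt_wf): c => c IH.
apply: oadd_ole => [|d /olt_addP[db|[c' c'c dc]]].
- exact: ole_trans (ole_addl a b) (ole_addl _ _).
- exact: olt_le_trans (olt_add a db) (ole_addl _ _).
- apply: ole_lt_trans (olt_add _ c'c); apply: ole_trans (IH c' c'c).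
  by apply: oadd_le => //; apply: ole_refl.
Qed.

Definition omuln a n := omul a (iter n osucc ozero).

Lemma omuln0_le a b : ole (omuln a 0) b.
Proof. by apply/ole_osub => -[[]]. Qed.

Lemma omulnS a n : oeq (omuln a n.+1) (oadd (omuln a n) a).
Proof.
split; last exact: (olub_le (fun=> oadd (omuln a n) a) tt).
by apply/oleP => c /olub_lt[].
Qed.

Lemma omuln_add a n m : ole (oadd (omuln a n) (omuln a m)) (omuln a (n + m)).
Proof.
elim: m => [|m IH].
  rewrite addn0; apply: oadd_ole => [|b]; first exact: ole_refl.
  by move/olt_le_trans => /(_ _ (omuln0_le a ozero)) /olt0.
rewrite addnS; apply: ole_trans (proj2 (omulnS a (n + m))).
apply: (@ole_trans (oadd (omuln a n) (oadd (omuln a m) a))).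
  by apply: oadd_le; [apply: ole_refl|have [] := omulnS a m].
apply: ole_trans (oadd_assoc_le _ _ _) _.
by apply: oadd_le => //; apply: ole_refl.
Qed.

(** A power of [omega] is the supremum of the finite multiples of smaller powers. The disjunct
    [olt x oone] serves exponent 0, which has no smaller exponent. *)
Lemma olt_expP x c : olt x (oexp omega c) <->
  olt x oone \/ exists c' n, olt c' c /\ olt x (omuln (oexp omega c') n).
Proof.
split.
  case: c => Y g /olub_lt[[j|] xj]; [right|by left].
  have /olub_lt[n xn] := xj.
  exists (g j), n.+1; split; first by exists j; apply: ole_refl.
  exact: olt_le_trans xn (proj2 (omulnS _ _)).
move=> [x1|[c' [n [c'c xn]]]].
  exact: ole_lt_trans (iffLR (olt_succ _ _) x1) (oexp_gt0 c).
case: c c'c => Y g [j c'j]; apply/olub_lt; exists (Some j); apply/olub_lt.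
exists n => /=; apply: olt_le_trans (ole_addl _ _).
exact: olt_le_trans xn (omul_le _ (oexp_le c'j)).
Qed.

(** Both [x] and [y] lie below finite multiples of one smaller power, and the multiplicities add up;
    the strict bound on [x] absorbs its successor. The first hypothesis excludes exponent 0, where
    [x = y = 0] already gives sum 1. *)
Lemma oexp_principal c x y : olt oone (oexp omega c) ->
  olt x (oexp omega c) -> olt y (oexp omega c) ->
  olt (oadd (osucc x) y) (oexp omega c).
Proof.
move=> /olt_expP[/olt_irr//|[d [n [dc dn]]]].
(* The multiple [omuln (oexp omega d) n] found above 1 also bounds [z = 0]. *)
have bnd z : olt z (oexp omega c) ->
    exists c' n, olt c' c /\ olt z (omuln (oexp omega c') n).
  move=> /olt_expP[z1|//]; exists d, n; split=> //.
  exact: olt_trans z1 dn.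
move=> /bnd[cx [nx [cxc xnx]]] /bnd[cy [ny [cyc yny]]].
have [e [ec xe ye]] : exists e, [/\ olt e c, ole cx e & ole cy e].
  have [xy|/olt_ole yx] := ole_or_lt cx cy.
    by exists cy; split=> //; apply: ole_refl.
  by exists cx; split=> //; apply: ole_refl.
apply/olt_expP; right; exists e, (nx + ny)%N; split=> //.
apply: olt_le_trans (omuln_add _ _ _).
have {}xnx := olt_le_trans xnx (omul_le _ (oexp_le xe)).
have {}yny := olt_le_trans yny (omul_le _ (oexp_le ye)).
apply: ole_lt_trans (olt_add _ yny).
by apply: oadd_le; [apply/ole_succ|apply: ole_refl].
Qed.

(** Take the least [c] with [b <= omega ^ c]. Powers with smaller exponent are below [b] by
    minimality, so are their finite multiples by closure under sums, and these are cofinal in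
    [omega ^ c]. *)
Lemma principal_oexp b : olt ozero b ->
  (forall x y, olt x b -> olt y b -> olt (oadd (osucc x) y) b) ->
  exists c, oeq b (oexp omega c).
Proof.
move=> b0 bP.
have [c [bc cmin]] : exists c, oleast (fun c => ole b (oexp omega c)) c.
  by apply: (@oleast_ex _ b); apply: ole_exp.
exists c; split=> //; apply/oleP => x /olt_expP[/olt_succ x0|].
  exact: ole_lt_trans x0 b0.
move=> [c' [n [c'c xn]]]; apply: olt_trans xn _.
have c'b : olt (oexp omega c') b.
  by apply/oltNge => /cmin; apply/oltNge.
elim: n => [|n IH]; first exact: ole_lt_trans (omuln0_le _ ozero) b0.
apply: ole_lt_trans (proj1 (omulnS _ _)) _.
apply: ole_lt_trans (bP _ _ IH c'b).
by apply: oadd_le; [apply/olt_ole/olt_succ|]; apply: ole_refl.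
Qed.

(** * Growth and monotonicity of Veblen functions *)

Lemma is_veblen_lt m phi (a b : 'I_m -> Ord) (k : 'I_m) : is_veblen phi ->
  (forall j : 'I_m, (j < k)%N -> oeq (b j) (a j)) -> olt (b k) (a k) ->
  (forall j : 'I_m, (k < j)%N -> olt (b j) (phi a)) -> olt (phi b) (phi a).
Proof. by move=> /(_ a)[[_ H] _]; apply: H. Qed.

Lemma is_veblen_gt0 m phi (a : 'I_m -> Ord) : is_veblen phi -> olt ozero (phi a).
Proof.
by move=> /(_ a)[[[c [_ ca]] _] _]; apply: olt_le_trans (oexp_gt0 c) ca.
Qed.

(** Induction on the value of [a i], for all tuples at once: lowering this entry to [y] and zeroing
    the later ones strictly lowers the value, which is still at least [y]. *)
Lemma is_veblen_ge m phi (a : 'I_m -> Ord) (i : 'I_m) :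
  is_veblen phi -> ole (a i) (phi a).
Proof.
move=> Hphi; move Ex : (a i) => x; elim/(well_founded_ind olt_wf): x a Ex.
move=> x IH a ax; apply/oleP => y yx.
pose b (j : 'I_m) := if (j < i)%N then a j else if j == i then y else ozero.
have bi : b i = y by rewrite /b ltnn eqxx.
apply: ole_lt_trans (IH y yx b bi) _.
apply: (@is_veblen_lt _ _ _ _ i) => //; rewrite ?bi ?ax //.
  by move=> j ji; rewrite /b ji; apply: oeq_refl.
move=> j ij; rewrite /b ltnNge (ltnW ij) /= -val_eqE gtn_eqF //.
exact: is_veblen_gt0.
Qed.

(** Zeroing the entries from [k] on strictly lowers the value, and the lowered value still bounds
    [a i]. *)
Lemma is_veblen_gt m phi (a : 'I_m -> Ord) (i k : 'I_m) : is_veblen phi ->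
  (i < k)%N -> olt ozero (a k) -> olt (a i) (phi a).
Proof.
move=> Hphi ik ak.
pose b (j : 'I_m) := if (j < k)%N then a j else ozero.
have -> : a i = b i by rewrite /b ik.
apply: ole_lt_trans (is_veblen_ge b i Hphi) _.
apply: (@is_veblen_lt _ _ _ _ k) => //.
- by move=> j jk; rewrite /b jk; apply: oeq_refl.
- by rewrite /b ltnn.
- by move=> j kj; rewrite /b ltnNge (ltnW kj); apply: is_veblen_gt0.
Qed.

(** By minimality of [phi a] it suffices that [phi b] meets the closure condition for [a]. A tuple
    dropping below [a] at [k] drops below [b] at the first [i < k] with [a i < b i], or at [k] if
    there is none. *)
Lemma is_veblen_mono m phi (a b : 'I_m -> Ord) : is_veblen phi ->
  (forall i, ole (a i) (b i)) -> ole (phi a) (phi b).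
Proof.
move=> Hphi ab; have [_ amin] := Hphi a; apply: amin; split.
  by have [[]] := Hphi b.
move=> k a' pre a'k post.
have [[j [jk jab]]|Nj] := pselect (exists j : 'I_m, (j < k)%N /\ olt (a j) (b j)).
  pose P (i : 'I_m) := (i < k)%N && `[< olt (a i) (b i) >].
  have Pj : P j by rewrite /P jk; apply/asboolP.
  case: (arg_minnP (@nat_of_ord m) Pj) => i /andP[ik /asboolP iab] imin.
  apply: (@is_veblen_lt _ _ _ _ i) => //.
  - move=> l li; apply: oeq_trans (pre l (ltn_trans li ik)) _; split=> //.
    have [//|lab] := ole_or_lt (b l) (a l).
    have := imin l; rewrite leqNgt li /P (ltn_trans li ik) /=.
    by move=> imin_l; have /imin_l : `[< olt (a l) (b l) >] by apply/asboolP.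
  - exact: ole_lt_trans (proj1 (pre i ik)) iab.
  (* Entries strictly between [i] and [k] stay below [phi b] because [b k] is positive. *)
  - move=> l il; case: (ltngtP l k) => [lk|kl|/val_inj ->].
    + apply: ole_lt_trans (proj1 (pre l lk)) _.
      apply: ole_lt_trans (ab l) _; apply: (is_veblen_gt Hphi lk).
      exact: olt_le_trans (ole_lt_trans (ole0o _) a'k) (ab k).
    + exact: post.
    + apply: olt_le_trans a'k _; apply: ole_trans (ab k) _.
      exact: is_veblen_ge.
apply: (@is_veblen_lt _ _ _ _ k) => //; last exact: olt_le_trans a'k (ab k).
move=> j jk; apply: oeq_trans (pre j jk) _; split=> //.
have [//|jab] := ole_or_lt (b j) (a j).
by case: Nj; exists j.
Qed.

Lemma wf_min T (r : T -> T -> Prop) (S : T -> Prop) x : well_founded r -> S x ->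
  exists2 y, S y & forall z, S z -> ~ r z y.
Proof.
move=> wf; elim/(well_founded_ind wf): x => x IH Sx.
have [[z [Sz zx]]|H] := pselect (exists z, S z /\ r z x); first exact: IH zx Sz.
by exists x => // z Sz zx; apply: H; exists z.
Qed.

(** * Generation of the ordinals below [vtop] by [vsum], with [n = m + 3] *)

Section VeblenClosure.
Variable m : nat.
Implicit Types a b : 'I_m.+3 -> Ord.

Definition pad0 a : 'I_m.+4 -> Ord :=
  fun j => if unlift ord0 j is Some i then a i else ozero.

Definition set0th x a : 'I_m.+3 -> Ord := fun i => if i == ord0 then x else a i.

Local Notation i1 := (inord 1 : 'I_m.+3).
Local Notation i2 := (inord 2 : 'I_m.+3).
Local Notation V := (@veblen m.+4).

(** The index [None] carries the additive term. The other indices run over the given presentation of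
    [a ord0], which is cofinal below it; there are none when [a ord0] is 0, so that the additive
    term can stand alone. *)
Definition vsum a : Ord :=
  olub (fun s : option (oidx (a ord0)) =>
    if s is Some x then V (pad0 (set0th (osub x) a))
    else oadd (osucc (a i2)) (a i1)).

Definition vtop : Ord := V (fun i => if i == ord0 then oone else ozero).

Lemma i1_neq0 : (i1 == ord0) = false.
Proof. by rewrite -val_eqE /= inordK. Qed.

Lemma i2_neq0 : (i2 == ord0) = false.
Proof. by rewrite -val_eqE /= inordK. Qed.

Lemma i2_neq1 : (i2 == i1) = false.
Proof. by rewrite -val_eqE /= !inordK. Qed.

Lemma V_set0th_le x y a b : ole x y -> (forall i, ole (a i) (b i)) ->
  ole (V (pad0 (set0th x a))) (V (pad0 (set0th y b))).
Proof.
move=> xy ab; apply: (is_veblen_mono (@veblenP _)) => j; rewrite /pad0.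
by case: unlift => [k|]; [rewrite /set0th; case: eqP|apply: ole_refl].
Qed.

Lemma olt_vsum x a : olt x (vsum a) <->
  olt x (oadd (osucc (a i2)) (a i1)) \/
  exists2 y, olt y (a ord0) & olt x (V (pad0 (set0th y a))).
Proof.
split.
  move=> /olub_lt[[i|] xi]; [right|by left].
  by exists (osub i) => //; apply: osub_lt.
move=> [xa|[y /olt_osub[i yi] xy]]; apply/olub_lt; first by exists None.
exists (Some i); apply: olt_le_trans xy _.
by apply: V_set0th_le => [//|k]; apply: ole_refl.
Qed.

Lemma vsum_mono a b : (forall i, ole (a i) (b i)) -> ole (vsum a) (vsum b).
Proof.
move=> ab; apply/oleP => x /olt_vsum[xa|[y ya xy]]; apply/olt_vsum.
  by left; apply: olt_le_trans xa _; apply: oadd_le.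
right; exists y; first exact: olt_le_trans ya (ab _).
apply: olt_le_trans xy _.
by apply: V_set0th_le => //; apply: ole_refl.
Qed.

Lemma vtop_veblen a : (forall i, olt (a i) vtop) -> olt (V (pad0 a)) vtop.
Proof.
move=> at_; apply: (@is_veblen_lt _ _ _ _ ord0 (@veblenP _)) => //.
  by rewrite /pad0 unlift_none; exists tt; apply: ole_refl.
move=> j j0; rewrite /pad0; case: unliftP => [i _|jE]; first exact: at_.
by rewrite jE in j0.
Qed.

Lemma vsum_lt_vtop a : (forall i, olt (a i) vtop) -> olt (vsum a) vtop.
Proof.
move=> at_.
have [c [tc ct]] : exists c, oeq vtop (oexp omega c).
  by have [[]] := @veblenP m.+4 (fun i => if i == ord0 then oone else ozero).
have top0 : olt ozero vtop by apply: is_veblen_gt0; apply: veblenP.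
have sum_lt : olt (oadd (osucc (a i2)) (a i1)) vtop.
  apply: olt_le_trans ct; apply: oexp_principal.
  (* [1 <= V(0, ..., 0) < vtop], so [vtop] is not the power with exponent 0. *)
  - apply: olt_le_trans tc; apply: ole_lt_trans (@vtop_veblen (fun=> ozero) (fun=> top0)).
    by apply: (iffRL (ole_succ ozero _)); apply: is_veblen_gt0; apply: veblenP.
  - exact: olt_le_trans (at_ _) tc.
  - exact: olt_le_trans (at_ _) tc.
have V_lt : olt (V (pad0 (set0th (a ord0) a))) vtop.
  by apply: vtop_veblen => i; rewrite /set0th; case: eqP.
(* The larger of the sum and [V(0, a)] bounds [vsum a], and both are below [vtop]. *)
have [le|lt] := ole_or_lt (V (pad0 (set0th (a ord0) a))) (oadd (osucc (a i2)) (a i1)).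
  apply: ole_lt_trans sum_lt; apply/oleP => x /olt_vsum[//|[y ya xy]].
  apply: olt_le_trans le; apply: olt_le_trans xy _.
  by apply: V_set0th_le => [|i]; [apply: olt_ole|apply: ole_refl].
apply: ole_lt_trans V_lt; apply/oleP => x /olt_vsum[xs|[y ya xy]].
  exact: olt_trans xs lt.
apply: olt_le_trans xy _.
by apply: V_set0th_le => [|i]; [apply: olt_ole|apply: ole_refl].
Qed.

Lemma veblen_normal_form c d : olt d vtop -> oeq d (oexp omega c) ->
  exists2 a, (forall i, olt (a i) d) & oeq (V (pad0 a)) d.
Proof.
move=> dt dc.
pose S (a : 'I_m.+4 -> Ord) := [/\ ole (a ord0) ozero,
  forall j : 'I_m.+4, j != ord0 -> olt (a j) d & ole d (V a)].
have [x Sx] : exists x, S x.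
  (* Without such a tuple, [d] would meet the closure condition defining [vtop], so [vtop <= d]. *)
  apply: contrapT => NS; apply: (iffLR (oltNge _ _) dt).
  have [_ tmin] := @veblenP m.+4 (fun i => if i == ord0 then oone else ozero).
  apply: tmin; split; first by exists c.
  move=> k a' _ a'k post; apply/oltNge => da'; apply: NS; exists a'.
  have k0 : k = ord0 by apply/eqP; case: eqP a'k => // _ /olt0.
  subst k; split=> // [|j j0]; first by move: a'k; rewrite eqxx => /olt_succ.
  by apply: post; rewrite lt0n.
have [b [b00 bd dVb] bmin] := wf_min (@lexlt_wf _) Sx.
have bE : oeq (V (pad0 (fun i => b (lift ord0 i)))) (V b).
  split; apply: (is_veblen_mono (@veblenP _)) => j; rewrite /pad0;
    case: unliftP => [i ->|->] //; try exact: ole_refl; exact: ole0o.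
exists (fun i => b (lift ord0 i)) => [i|]; first exact: bd.
apply: oeq_trans bE _; split=> //.
(* A tuple dropping below [b] whose value reaches [d] would again satisfy [S], against minimality of
   [b]. Hence [d] meets the closure condition for [b]. *)
have [_ Vmin] := @veblenP m.+4 b; apply: Vmin; split; first by exists c.
move=> k a' pre a'k post; apply/oltNge => da'; apply: (bmin a'); last by exists k.
have k0 : (0 < k)%N.
  rewrite lt0n; apply/eqP => kn0; have k0 : k = ord0 by apply: val_inj.
  by move: a'k; rewrite k0 => /olt_le_trans/(_ b00)/olt0.
split=> // [|j j0]; first exact: ole_trans (proj1 (pre ord0 k0)) b00.
have [jk|kj|/val_inj ->] := ltngtP j k.
- exact: ole_lt_trans (proj1 (pre _ jk)) (bd _ j0).
- exact: post.
- by apply: olt_trans a'k (bd _ _); rewrite -val_eqE -lt0n.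
Qed.

Lemma vsum_surj d : olt d vtop -> olt ozero d ->
  exists2 a, (forall i, olt (a i) d) & oeq (vsum a) d.
Proof.
move=> dt d0.
have [[x [y [xd yd dxy]]]|nadd] :=
    pselect (exists x y, [/\ olt x d, olt y d & ole d (oadd (osucc x) y)]).
  (* Every [z' < z] gives a sum below [d], so the sum with [z] is exactly [d]. *)
  have [z [zd zmin]] := @oleast_ex (fun z => ole d (oadd (osucc x) z)) y dxy.
  pose a (i : 'I_m.+3) := if i == i1 then z else if i == i2 then x else ozero.
  have a0 : a ord0 = ozero by rewrite /a 2!(eq_sym ord0) i1_neq0 i2_neq0.
  have a1 : a i1 = z by rewrite /a eqxx.
  have a2 : a i2 = x by rewrite /a i2_neq1 eqxx.
  exists a.
    move=> i; rewrite /a; case: eqP => _; last by case: eqP.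
    exact: ole_lt_trans (zmin y dxy) yd.
  split; last first.
    by apply/oleP => w wd; apply/olt_vsum; left; rewrite a1 a2; apply: olt_le_trans wd zd.
  apply/oleP => w /olt_vsum[|[v]]; last by rewrite a0 => /olt0.
  rewrite a1 a2 => wz; apply: olt_le_trans wz _; apply: oadd_ole.
    exact/ole_succ.
  by move=> z' z'z; apply/oltNge => /zmin; apply: (iffLR (oltNge _ _) z'z).
have {}nadd x y : olt x d -> olt y d -> olt (oadd (osucc x) y) d.
  by move=> xd yd; apply/oltNge => dxy; apply: nadd; exists x, y.
have [c dc] := principal_oexp d0 nadd.
have [a ad aV] := veblen_normal_form dt dc.
have succ_lt x : olt x d -> olt (osucc x) d.
  by move=> xd; apply: ole_lt_trans (nadd x ozero xd d0); apply: ole_addl.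
(* The supremum in [vsum] is over ordinals strictly below entry 0; the successor makes [V(0, a)] its
   largest term. The additive term stays below [d] by [nadd]. *)
exists (set0th (osucc (a ord0)) a).
  by move=> i; rewrite /set0th; case: eqP => // _; apply: succ_lt.
have setE y : oeq (V (pad0 (set0th (a ord0) (set0th y a)))) (V (pad0 a)).
  have E k : set0th (a ord0) (set0th y a) k = a k.
    by rewrite /set0th; case: eqP => [->|].
  by split; apply: (is_veblen_mono (@veblenP _)) => j; rewrite /pad0;
    case: unlift => [k|]; rewrite ?E; apply: ole_refl.
split.
  apply/oleP => w /olt_vsum[|[y]].
    rewrite /set0th i1_neq0 i2_neq0 => /olt_trans; apply; exact: nadd.
  rewrite /set0th eqxx => /olt_succ ya wy.
  apply: olt_le_trans (proj1 aV); apply: olt_le_trans wy _.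
  apply: ole_trans (proj1 (setE (osucc (a ord0)))).
  by apply: V_set0th_le => // i; apply: ole_refl.
apply: ole_trans (proj2 aV) _; apply/oleP => w wa; apply/olt_vsum; right.
exists (a ord0); first by rewrite /set0th eqxx; apply/olt_succ; apply: ole_refl.
exact: olt_le_trans wa (proj2 (setE _)).
Qed.

(** Evaluates terms built from 0 by [vsum], coded in a countable type; missing arguments default to
    0. *)
Fixpoint veval (t : GenTree.tree unit) : Ord :=
  match t with
  | GenTree.Leaf _ => ozero
  | GenTree.Node _ s => vsum (fun i => nth ozero (map veval s) i)
  end.

Lemma veval_surj d : olt d vtop -> exists t, oeq (veval t) d.
Proof.
elim/(well_founded_ind olt_wf): d => d IH dt.
have [d0|d0] := ole_or_lt d ozero.
  by exists (GenTree.Leaf tt); split=> //; apply: ole0o.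
have [a ad aE] := vsum_surj dt d0.
have /choice[t tE] : forall i, exists t, oeq (veval t) (a i).
  by move=> i; apply: IH => //; apply: olt_trans dt.
exists (GenTree.Node 0 [seq t i | i <- enum 'I_m.+3]); apply: oeq_trans aE.
have nthE (i : 'I_m.+3) :
    nth ozero (map veval [seq t i | i <- enum 'I_m.+3]) i = veval (t i).
  by rewrite -map_comp (nth_map i) ?size_enum_ord //= nth_ord_enum.
by split; apply: vsum_mono => i; rewrite nthE; have [] := tE i.
Qed.

Lemma vtop_countable :
  exists u : nat -> Ord, forall d, olt d vtop -> exists k, oeq (u k) d.
Proof.
exists (fun k => if unpickle k is Some t then veval t else ozero) => d /veval_surj[t td].
by exists (pickle t); rewrite pickleK.
Qed.

End VeblenClosure.

(** * Continuous monotone extension from a grid *)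

(** For [w > 0]: 0 up to [s - w], linear from there to [s], and 1 from [s] on. *)
Definition ramp (R : realType) (s w t : R) : R :=
  Num.max 0 (Num.min 1 (1 + (t - s) / w)).

Lemma ramp_ge (R : realType) (s w t : R) : 0 < w -> s <= t -> ramp s w t = 1.
Proof.
move=> w0 st; rewrite /ramp min_l ?max_r //.
by rewrite lerDl divr_ge0 ?subr_ge0 // ltW.
Qed.

Lemma ramp_le (R : realType) (s w t : R) : 0 < w -> t + w <= s -> ramp s w t = 0.
Proof.
move=> w0 st; rewrite /ramp max_l // ge_min; apply/orP; right.
have -> : 1 + (t - s) / w = (w + (t - s)) / w by rewrite [RHS]mulrDl divff // gt_eqF.
by rewrite mulr_le0_ge0 ?invr_ge0 ?(ltW w0) //; lra.
Qed.

Lemma ramp_ge0 (R : realType) (s w t : R) : 0 <= ramp s w t.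
Proof. by rewrite /ramp le_max lexx. Qed.

Lemma ramp_mono (R : realType) (s w t t' : R) : 0 < w -> t <= t' ->
  ramp s w t <= ramp s w t'.
Proof.
move=> w0 tt'; rewrite /ramp ge_max !le_max lexx /=; apply/orP; right.
rewrite le_min !ge_min lexx /=; apply/orP; right.
by rewrite lerD2l ler_pM2r ?invr_gt0 // lerD2r.
Qed.

Lemma ramp_near (R : realType) (s w p e : R) : 0 < w -> 0 < e ->
  \forall t \near p, ramp s w p - e < ramp s w t /\ ramp s w t < ramp s w p + e.
Proof.
move=> w0 e0.
have cr : {for p, continuous (ramp s w)}.
  apply: continuous_max; first exact: cvg_cst.
  apply: continuous_min; first exact: cvg_cst.
  apply: cvgD; first exact: cvg_cst.
  apply: cvgM; last exact: cvg_cst.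
  apply: cvgB; [exact: cvg_id|exact: cvg_cst].
move/cvgrPdist_lt : cr => /(_ e e0); apply: filterS => t.
by rewrite ltr_norml => /andP[? ?]; split; lra.
Qed.

(* Below [p] the ramps are already saturated, and above the least point [s0] of
   [X] beyond [p] they vanish near [p]; so only the ramp at [s0] matters, and [w]
   need not be bounded below. *)
Lemma ramp_equicontinuous (R : realType) (X : set R) (w : R -> R) (p e : R) :
  (forall t, X t -> 0 < w t) ->
  (forall s t, X s -> X t -> s < t -> s + w t <= t) ->
  ((exists2 s, X s & p < s) ->
    exists s, [/\ X s, p < s & forall t, X t -> p < t -> s <= t]) ->
  0 < e ->
  \forall t \near p, forall s, X s -> ramp s (w s) t <= ramp s (w s) p + e.
Proof.
move=> w0 gap Xmin e0.
have low t s : X s -> s <= p -> ramp s (w s) t <= ramp s (w s) p + e.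
  move=> Xs sp; rewrite (ramp_ge (w0 s Xs) sp).
  by rewrite /ramp ge_max ge_min; apply/andP; split; [lra|apply/orP; left; lra].
have [[s1 Xs1 ps1]|Np] := pselect (exists2 s, X s & p < s); last first.
  apply: filterE => t s Xs; apply: low => //; rewrite leNgt; apply/negP => ps.
  by apply: Np; exists s.
have [s0 [Xs0 ps0 s0min]] := Xmin (ex_intro2 _ _ s1 Xs1 ps1).
have nt : \forall t \near p, t < s0 by apply: lt_nbhsl.
near=> t => s Xs; have [sp|ps] := leP s p; first exact: low.
have := s0min s Xs ps; rewrite le_eqVlt => /predU1P[<-|s0s].
  suff [_ /ltW] : ramp s0 (w s0) p - e < ramp s0 (w s0) t /\
    ramp s0 (w s0) t < ramp s0 (w s0) p + e by [].
  by near: t; apply: ramp_near => //; apply: w0.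
have ts0 : t < s0 by near: t.
have gs := gap _ _ Xs0 Xs s0s.
rewrite ramp_le ?w0 //; last by lra.
by rewrite addr_ge0 ?ramp_ge0 // ltW.
Unshelve. all: by end_near. Qed.

(** The extension at [x] is the supremum over grid points [a] of the minimum of [v a] and the ramps
    at the [a_i] evaluated at [x_i]. The ramps increase, so it is monotone. *)
Lemma monotone_continuous_extension (R : realType) (n : nat) (X : set R)
    (w : R -> R) (v : 'rV[R]_n -> R) :
  (forall t, X t -> 0 < w t) ->
  (forall s t, X s -> X t -> s < t -> s + w t <= t) ->
  (forall p, (exists2 s, X s & p < s) ->
    exists s, [/\ X s, p < s & forall t, X t -> p < t -> s <= t]) ->
  (forall x : 'rV[R]_n, (forall i, X (x 0 i)) -> 0 <= v x <= 1) ->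
  (forall x y : 'rV[R]_n, (forall i, X (x 0 i)) -> (forall i, X (y 0 i)) ->
    (forall i, x 0 i <= y 0 i) -> v x <= v y) ->
  exists g : 'rV[R]_n -> R, [/\ continuous g, mv_monotone g &
    forall x : 'rV[R]_n, (forall i, X (x 0 i)) -> g x = v x].
Proof.
move=> w0 gap Xmin v01 vmono.
(* The value 0 keeps [S x] nonempty and [g] nonnegative. *)
pose S (x : 'rV[R]_n) := [set y : R | y = 0 \/ exists a : 'rV[R]_n,
  [/\ forall i, X (a 0 i), y <= v a &
      forall i, y <= ramp (a 0 i) (w (a 0 i)) (x 0 i)]].
pose g x := sup (S x).
have Sn0 x : S x !=set0 by exists 0; left.
have Sub x : has_ubound (S x).
  exists 1 => y [->//|[a [Xa ya _]]]; apply: le_trans ya _.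
  by have /andP[] := v01 a Xa.
have Sg x y : S x y -> y <= g x by move=> Sy; apply: ub_le_sup.
have g0 x : 0 <= g x by apply: Sg; left.
have gle x c : (forall y, S x y -> y <= c) -> g x <= c.
  by move=> H; apply: ge_sup => // y; apply: H.
exists g; split.
- move=> p; apply/(@cvgrPdist_le _ _ _ (nbhs p)) => e e0.
  (* Uniformly in the grid point, each positive candidate at [x] becomes one at [p] after
     subtracting [e]. *)
  have up : nbhs p [set x : 'rV[R]_n | g x <= g p + e].
    have /(@filter_forall _ _ _ (nbhs p) _) : forall i : 'I_n, nbhs p [set x : 'rV[R]_n |
        forall s, X s -> ramp s (w s) (x 0 i) <= ramp s (w s) (p 0 i) + e].
      move=> i; have H := ramp_equicontinuous w0 gap (Xmin (p 0 i)) e0.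
      exact: (@coord_continuous R 1 n 0 i p _ H).
    apply: (@filterS _ (nbhs p)) => x /= Hx; apply: gle => y [->|[a [Xa ya yr]]].
      by rewrite addr_ge0 // ltW.
    rewrite -lerBlDr; apply: Sg; right; exists a; split=> // [|i].
      by apply: le_trans ya; rewrite gerBl ltW.
    by rewrite lerBlDr; apply: le_trans (yr i) (Hx i _ (Xa i)).
  (* One grid point nearly attaining [g p] suffices; its finitely many ramps are continuous. *)
  have low : nbhs p [set x : 'rV[R]_n | g p <= g x + e].
    have e2 : 0 < e / 2 by rewrite divr_gt0.
    have [y Sy gy] := sup_adherent e2 (conj (Sn0 p) (Sub p)).
    rewrite -/(g p) in gy.
    case: Sy => [y0|[a [Xa ya yr]]].
      by apply: filterE => x /=; have := g0 x; lra.
    have /(@filter_forall _ _ _ (nbhs p) _) : forall i : 'I_n, nbhs p [set x : 'rV[R]_n |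
        ramp (a 0 i) (w (a 0 i)) (p 0 i) - e / 2 < ramp (a 0 i) (w (a 0 i)) (x 0 i)].
      move=> i; have H := ramp_near (a 0 i) (p 0 i) (w0 _ (Xa i)) e2.
      have := @coord_continuous R 1 n 0 i p _ H.
      by apply: (@filterS _ (nbhs p)) => x [].
    apply: (@filterS _ (nbhs p)) => x /= Hx.
    suff : y - e / 2 <= g x by lra.
    apply: Sg; right; exists a; split=> // [|i].
      by apply: le_trans ya; rewrite gerBl ltW.
    by have := yr i; have := Hx i; lra.
  near=> x; rewrite ler_norml; apply/andP; split.
    by rewrite lerNl opprB lerBlDl; near: x.
  by rewrite lerBlDl; near: x.
- move=> i x y xy xyi; apply: gle => z [->//|[a [Xa za zr]]].
  apply: Sg; right; exists a; split=> // j; apply: le_trans (zr j) _.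
  apply: ramp_mono; first exact: w0.
  by have [->//|ji] := eqVneq j i; rewrite xy.
(* At a grid point [x], taking [a = x] gives [v x]. If some [a_i] exceeds [x_i], its ramp vanishes
   there by [gap]; otherwise [v a <= v x]. *)
- move=> x Xx; apply/eqP; rewrite eq_le; apply/andP; split; last first.
    have /andP[_ v1] := v01 x Xx.
    by apply: Sg; right; exists x; split=> // i; rewrite ramp_ge // w0.
  have /andP[vx0 _] := v01 x Xx.
  apply: gle => y [->//|[a [Xa ya yr]]].
  have [[i xa]|Na] := pselect (exists i, x 0 i < a 0 i).
    apply: le_trans (yr i) _; rewrite ramp_le ?w0 //; exact: gap.
  apply: le_trans ya (vmono _ _ Xa Xx _) => i.
  by rewrite leNgt; apply/negP => ai; apply: Na; exists i.
Unshelve. all: by end_near. Qed.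

(** * Embedding of countably many ordinals in the unit interval *)

(** Let [e a] be the sum of [2^-(k+1)] over all [k] with [0 < u k <= a]: crossing [u k] adds at
    least the weight [w k]. Requiring [0 < u k] gives [e 0 = 0]. *)
Lemma countable_embedding (R : realType) (u : nat -> Ord) :
  exists (e : Ord -> R) (w : nat -> R), [/\ forall k, 0 < w k,
    forall a, 0 <= e a <= 1, e ozero = 0,
    forall a b, ole a b -> e a <= e b &
    forall a b k, olt a (u k) -> ole (u k) b -> e a + w k <= e b].
Proof.
pose w k : R := 2^-1 ^+ k.+1.
have w0 k : 0 < w k by rewrite exprn_gt0 // invr_gt0.
pose F a k := if `[< olt ozero (u k) /\ ole (u k) a >] then w k else 0.
have F0 a k : 0 <= F a k by rewrite /F; case: ifP => // _; apply: ltW.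
have Fw a k : F a k <= w k by rewrite /F; case: ifP => // _; apply: ltW.
have Fmono a b k : ole a b -> F a k <= F b k.
  move=> ab; rewrite {1}/F; case: asboolP => // -[uk ua]; rewrite /F asboolT //.
  by split=> //; apply: ole_trans ab.
pose S a N := \sum_(k < N) F a k.
have S0 a N : 0 <= S a N by apply: sumr_ge0.
have S1 a N : S a N <= 1.
  apply: (@le_trans _ _ (\sum_(k < N) w k)); first exact: ler_sum.
  suff -> : \sum_(k < N) w k = 1 - 2^-1 ^+ N by rewrite gerBl exprn_ge0 // invr_ge0.
  elim: N => [|N IH]; first by rewrite big_ord0 expr0 subrr.
  by rewrite big_ord_recr /= IH /w exprS; lra.
have ubS a : has_ubound (range (S a)) by exists 1 => _ [N _ <-].
pose e a := sup (range (S a)).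
have Se a N : S a N <= e a by apply: ub_le_sup => //; exists N.
have leS a c : (forall N, S a N <= c) -> e a <= c.
  by move=> H; apply: ge_sup => [|_ [N _ <-]//]; exists (S a 0%N), 0%N.
exists e, w; split=> //.
- move=> a; rewrite leS // andbT; exact: le_trans (S0 a 0%N) (Se a 0%N).
- apply/eqP; rewrite eq_le (le_trans (S0 _ 0%N) (Se _ 0%N)) andbT leS // => N.
  rewrite /S big1 // => k _; rewrite /F asboolF // => -[uk uk0].
  exact: olt_irr (olt_le_trans uk uk0).
- move=> a b ab; apply: leS => N; apply: le_trans (Se b N).
  by apply: ler_sum => k _; apply: Fmono.
- move=> a b k ak kb; rewrite -lerBrDr; apply: leS => N; rewrite lerBrDr.
  (* The partial sum is lengthened so that it contains the term of index [k]. *)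
  apply: le_trans (Se b (N + k.+1)%N).
  have kN : (k < N + k.+1)%N by rewrite addnS ltnS leq_addl.
  apply: (@le_trans _ _ (S a (N + k.+1)%N + w k)).
    by rewrite lerD2r /S big_split_ord /= lerDl; apply: sumr_ge0.
  rewrite /S (bigD1 (Ordinal kN)) //= [leRHS](bigD1 (Ordinal kN)) //=.
  have -> : F a k = 0.
    by rewrite /F asboolF // => -[_ /(olt_le_trans ak)/olt_irr].
  have -> : F b k = w k.
    by rewrite /F asboolT //; split=> //; apply: ole_lt_trans (ole0o a) ak.
  rewrite add0r [leLHS]addrC; apply: lerD => //; apply: ler_sum => j _; apply: Fmono.
  exact: olt_ole (olt_le_trans ak kb).
Qed.

(** * Transfer of [vsum] to the reals *)

Theorem theorem1p3 (R : realType) (n : nat) (hn : (3 <= n)%N) :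
  exists g : 'rV[R]_n -> R,
    [/\ continuous g, mv_monotone g &
     has_order_type
       (generated [set (existT (fun k : nat => 'rV[R]_k -> R) n g : mvfun R)] [set 0])
       (veblen (fun i : 'I_n.+1 => if i == ord0 then oone else ozero))].
Proof.
case: n hn => [|[|[|m]]] // _.
change (veblen _) with (vtop m).
have [u uP] := vtop_countable m.
have [e [wt [wt0 e01 e0 emono egap]]] := countable_embedding R u.
have elt a b : olt b (vtop m) -> olt a b -> e a < e b.
  move=> /uP[k [kb bk]] ab; apply: lt_le_trans (egap _ _ k (olt_le_trans ab bk) kb).
  by rewrite ltrDl.
have olt_e a b : e a < e b -> olt a b.
  by move=> ab; apply/oltNge => /emono; rewrite leNgt ab.
have ole_e a b : olt a (vtop m) -> e a <= e b -> ole a b.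
  move=> at_ ab; have [//|ba] := ole_or_lt a b.
  by have := elt _ _ at_ ba; rewrite ltNge ab.
pose X := [set x : R | exists2 a, olt a (vtop m) & e a = x].
have /choice[w wP] : forall t, exists w, X t ->
    0 < w /\ forall s, X s -> s < t -> s + w <= t.
  move=> t; have [[b bt <-]|nX] := pselect (X t); last by exists 0.
  have [k [kb bk]] := uP b bt; exists (wt k) => _; split=> // _ [a _ <-] /olt_e ab.
  by apply: egap kb; apply: olt_le_trans bk.
(* [f] inverts [e] on the grid [X]; [v] below is [vsum] read through this correspondence. *)
have /choice[f fP] : forall x, exists a, X x -> olt a (vtop m) /\ e a = x.
  move=> x; have [[a at_ <-]|nX] := pselect (X x); first by exists a.
  by exists ozero.
pose v (x : 'rV[R]_m.+3) := e (vsum (fun i => f (x 0 i))).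
have [|||||g [gc gm gv]] := @monotone_continuous_extension R m.+3 X w v.
- by move=> t /wP[].
- by move=> s t Xs /wP[_]; apply.
(* The least grid point above [p] comes from the well-foundedness of the ordinals. *)
- move=> p [_ [a at_ <-] pa].
  have [b [[bt pb] bmin]] :=
    @oleast_ex (fun a => olt a (vtop m) /\ p < e a) a (conj at_ pa).
  exists (e b); split=> [|//|_ [c ct <-] pc]; first by exists b.
  exact/emono/bmin.
- by move=> x _; apply: e01.
- move=> x y Xx Xy xy; apply: emono; apply: vsum_mono => i.
  have [fx ex] := fP _ (Xx i); have [fy ey] := fP _ (Xy i).
  by apply: ole_e => //; rewrite ex ey.
exists g; split=> //.
set G := [set _]; set F := generated G [set 0].
have gE a : (forall i, olt (a i) (vtop m)) -> g (\row_i e (a i)) = e (vsum a).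
  move=> at_; have Xa i : X ((\row_i e (a i)) 0 i) by rewrite mxE; exists (a i).
  rewrite gv // /v; apply/eqP; rewrite eq_le; apply/andP; split;
    apply: emono; apply: vsum_mono => i; have [fa ea] := fP _ (Xa i);
    by apply: ole_e => //; rewrite ea mxE.
have top0 : olt ozero (vtop m) by apply: is_veblen_gt0; apply: veblenP.
(* The grid contains 0 and is closed under [g], since [vtop] is closed under [vsum]. *)
have FX x : F x -> X x.
  move=> Fx; apply: (Fx X); split; last by move=> _ ->; exists ozero.
  move=> _ -> /= y Xy _; rewrite gv //.
  exists (vsum (fun i => f (y 0 i))) => //.
  by apply: vsum_lt_vtop => i; have [] := fP _ (Xy i).
have XF a : olt a (vtop m) -> F (e a).
  elim/(well_founded_ind olt_wf): a => d IH dt.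
  have [d0|d0] := ole_or_lt d ozero.
    have -> : e d = 0.
      by apply/eqP; rewrite eq_le -{1}e0 emono //; have /andP[] := e01 d.
    by move=> Y [_]; apply.
  (* The arguments are below [d], so they are generated by induction, and strict monotonicity of [e]
     gives the required [x_i < g x]. *)
  have [a ad [da aE]] := vsum_surj dt d0.
  have at_ i : olt (a i) (vtop m) by apply: olt_trans dt.
  have ed : e d = g (\row_i e (a i)).
    by rewrite gE //; apply/eqP; rewrite eq_le !emono.
  rewrite ed; apply: (@generated_closed R G [set 0] (existT _ m.+3 g)) => //= i.
    by rewrite mxE; apply: IH.
  by rewrite -ed mxE; apply: elt.
exists f; split=> [x y /FX/fP[fx ex] /FX/fP[fy ey]|b].
  by split=> [xy|/(elt _ _ fy)]; [apply: olt_e|]; rewrite ex ey.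
split=> [bt|[x /FX/fP[fx ex] [xb bx]]]; last exact: ole_lt_trans bx fx.
have [fb eb] := fP (e b) (ex_intro2 _ _ b bt erefl).
exists (e b); first exact: XF.
by split; apply: ole_e => //; rewrite eb.
Qed.
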